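(* Let $G$ be a group and let $\mathcal{D}$ be the deformation space of a $G$-tree. Then any two reduced marked graphs in $\mathcal{D}$ are related by a (finite) sequence of Whitehead moves (each of type I or type II).
   Context: Graphs. A graph has vertices $V$, oriented edges $E$, originating and terminal vertex maps $o,t\colon E\to V$, and a fixed-point-free involution $e\mapsto\bar e$ reversing orientation. A loop is an edge $e$ with $o(e)=t(e)$. A geometric edge is a pair $\{e,\bar e\}$; ``distinct geometric edges $e,f$'' means none of $e,\bar e,f,\bar f$ coincide. $G$-trees and marked graphs. A $G$-tree is a simplicial tree $T$ with an action of $G$ by simplicial automorphisms without inversions. Two $G$-trees are identified if they are $G$-equivariantly isomorphic. $T$ corresponds to its quotient graph of groups $T/G$ together with an identification of $G$ with its fundamental group; this is called a marked graph. Collapse and expansion. An edge $e$ of a marked graph $\Gamma$ is collapsible if it is not a loop and the inclusion $G_e\hookrightarrow G_{o(e)}$ is surjective. In the $G$-tree this means that $G_e=G_{o(e)}$ and the endpoints of $e$ are not in the same orbit. Collapsing $\{e,\bar e\}$ (all translates, in the tree) to a vertex is a collapse move; $o(e)$ and $t(e)$ merge into a vertex with group $G_{t(e)}$. The resulting marked graph is denoted $\Gamma_e$ (a geometric edge may be collapsed if $e$ or $\bar e$ is collapsible). If $F\subset\Gamma$ is a forest whose edges can be collapsed iteratively, the resulting marked graph is denoted $\Gamma_F$. The reverse of a collapse move is an expansion move. A marked graph is reduced if it admits no collapse move. The deformation space $\mathcal{D}$ of a $G$-tree $T$ is the set of all $G$-trees (equivalently marked graphs) related to $T$ by a finite sequence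 of collapse and expansion moves. Whitehead moves. Let $\Gamma,\Gamma'\in\mathcal{D}$ be reduced marked graphs. They are related by a type I Whitehead move if there is a marked graph $\Gamma''\in\mathcal{D}$ such that $\Gamma=\Gamma''_{e}$ and $\Gamma'=\Gamma''_{e'}$ for distinct geometric edges $e,e'\in E(\Gamma'')$. They are related by a type II Whitehead move if there is a marked graph $\Gamma''\in\mathcal{D}$ such that $\Gamma=\Gamma''_{e}$ and $\Gamma'=\Gamma''_{e'\cup f'}$ for distinct geometric edges $e,e',f'\in E(\Gamma'')$. Being related by a Whitehead move is regarded as a symmetric relation, and Whitehead moves are only defined between reduced marked graphs. *)

(* Defs.v *)
From mathcomp Require Import all_boot.
From mathcomp Require Import boolp classical_sets.
From Stdlib Require Import Relations.

Set Implicit Arguments.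
Unset Strict Implicit.
Unset Printing Implicit Defensive.

Local Open Scope group_scope.
Local Open Scope classical_set_scope.

Record ggraph (G : groupType) := GGraph {
  vert : Type;
  edge : Type;
  src : edge -> vert;
  tgt : edge -> vert;
  bar : edge -> edge;
  actv : G -> vert -> vert;
  acte : G -> edge -> edge;
  barK : forall e, bar (bar e) = e;
  bar_neq : forall e, bar e <> e;
  src_bar : forall e, src (bar e) = tgt e;
  actv1 : forall x, actv 1 x = x;
  actvM : forall g h x, actv (g * h) x = actv g (actv h x);
  acte1 : forall e, acte 1 e = e;
  acteM : forall g h e, acte (g * h) e = acte g (acte h e);
  act_src : forall g e, src (acte g e) = actv g (src e);
  act_bar : forall g e, bar (acte g e) = acte g (bar e)
}.

Section GGraph.
Variables (G : groupType) (X : ggraph G).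
Implicit Types (x y : vert X) (e f : edge X) (p : seq (edge X)).

Lemma tgt_bar e : tgt (bar e) = src e.
Proof. by rewrite -src_bar barK. Qed.

Lemma act_tgt g e : tgt (acte g e) = actv g (tgt e).
Proof. by rewrite -!src_bar act_bar act_src. Qed.

Fixpoint walk (S : set (edge X)) x p y : Prop :=
  if p is e :: q then [/\ S e, src e = x & walk S (tgt e) q y] else x = y.

Fixpoint no_backtrack p : Prop :=
  if p is e :: q
  then (if q is f :: _ then f <> bar e else True) /\ no_backtrack q
  else True.

Definition is_tree : Prop :=
  [/\ exists x : vert X, True,
      forall x y, exists p, walk setT x p y
    & forall x p, walk setT x p x -> no_backtrack p -> p = [::]].

Definition without_inversions : Prop := forall g e, acte g e <> bar e.

Definition stabv x : set G := [set g | actv g x = x].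
Definition stabe e : set G := [set g | acte g e = e].

Definition same_orbitv x y : Prop := exists g, y = actv g x.

(* When [X] is a [G]-tree, edges of the marked graph [X/G] are represented by
   their lifts to [X]. This says that two lifts give the same geometric edge
   of [X/G]. *)
Definition same_geom e f : Prop :=
  exists g, f = acte g e \/ f = acte g (bar e).

Definition collapsible e : Prop :=
  stabe e = stabv (src e) /\ ~ same_orbitv (src e) (tgt e).

Definition geom_collapsible e : Prop := collapsible e \/ collapsible (bar e).

Definition reduced : Prop := forall e, ~ collapsible e.

Lemma same_geom_bar e f : same_geom e (bar f) <-> same_geom e f.
Proof.
have H e' f' : same_geom e' f' -> same_geom e' (bar f').
  case=> g [->|->]; exists g; [right|left]; first by rewrite act_bar.
  by rewrite act_bar barK.
by split=> /H //; rewrite barK.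
Qed.

Lemma same_geom_act e g f : same_geom e (acte g f) <-> same_geom e f.
Proof.
have H e' f' h : same_geom e' f' -> same_geom e' (acte h f').
  by case=> k [->|->]; exists (h * k); [left|right]; rewrite acteM.
by split=> [/(H _ _ g^-1)|/H //]; rewrite -acteM mulVg acte1.
Qed.

End GGraph.

Section Collapse.
Variables (G : groupType) (X : ggraph G) (e : edge X).
Implicit Types (x y : vert X) (f : edge X) (g : G).

Definition component x : set (vert X) :=
  [set y | exists p, walk (same_geom e) x p y].

Definition cvert : Type := {A : set (vert X) | exists x, A = component x}.
Definition cedge : Type := {f : edge X | ~ same_geom e f}.

Definition cproj x : cvert := exist _ (component x) (ex_intro _ x erefl).

Lemma walk_act g x p y : walk (same_geom e) x p y ->
  walk (same_geom e) (actv g x) [seq acte g f | f <- p] (actv g y).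
Proof.
elim: p x => [x -> //|f p IH x /= [Sf <- /IH Hp]].
by split; rewrite ?act_src ?act_tgt //; apply/same_geom_act.
Qed.

Lemma component_act g x : [set actv g y | y in component x] =
  component (actv g x).
Proof.
apply/seteqP; split=> [_ [y [p Hp] <-]|y [p Hp]].
  by exists [seq acte g f | f <- p]; apply: walk_act.
exists (actv g^-1 y); last by rewrite -actvM mulgV actv1.
exists [seq acte g^-1 f | f <- p].
by have := walk_act g^-1 Hp; rewrite -actvM mulVg actv1.
Qed.

Lemma cactv_subproof g (A : cvert) :
  exists x, [set actv g y | y in sval A] = component x.
Proof. by case: A => A [x Ax] /=; exists (actv g x); rewrite Ax component_act. Qed.

Definition cactv g (A : cvert) : cvert := exist _ _ (cactv_subproof g A).

Definition cedge_of f (nef : ~ same_geom e f) : cedge :=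
  exist (fun f => ~ same_geom e f) f nef.

Definition cacte g (f : cedge) : cedge :=
  @cedge_of (acte g (sval f))
    (fun h => svalP f ((same_geom_act e g (sval f)).1 h)).

Definition cbar (f : cedge) : cedge :=
  @cedge_of (bar (sval f)) (fun h => svalP f ((same_geom_bar e (sval f)).1 h)).

Lemma cvert_inj (A B : cvert) : sval A = sval B -> A = B.
Proof. by case: A B => [A a] [B b] /= AB; subst B; congr exist. Qed.

Lemma cedge_inj (f h : cedge) : sval f = sval h -> f = h.
Proof. by case: f h => [f a] [h b] /= fh; subst h; congr exist. Qed.

Local Obligation Tactic := idtac.

(* Collapse of all translates of [e] and [bar e]: the vertices are the
   connected components of the subgraph of [X] with these edges, the edges are
   the remaining ones. *)
Program Definition collapse : ggraph G :=
  @GGraph G cvert cedge (fun f : cedge => cproj (src (sval f)))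
    (fun f : cedge => cproj (tgt (sval f))) cbar cactv cacte _ _ _ _ _ _ _ _ _.
Next Obligation. by move=> f; apply: cedge_inj; rewrite /= barK. Qed.
Next Obligation. by move=> f /(congr1 sval) /=; apply: bar_neq. Qed.
Next Obligation. by move=> f /=; rewrite src_bar. Qed.
Next Obligation.
move=> A; apply: cvert_inj => /=; apply/seteqP; split=> [_ [y Ay <-]|y Ay].
  by rewrite actv1.
by exists y; rewrite ?actv1.
Qed.
Next Obligation.
move=> g h A; apply: cvert_inj => /=; rewrite image_comp.
by apply: eq_imagel => y _ /=; rewrite actvM.
Qed.
Next Obligation. by move=> f; apply: cedge_inj; rewrite /= acte1. Qed.
Next Obligation. by move=> g h f; apply: cedge_inj; rewrite /= acteM. Qed.
Next Obligation.
by move=> g f; apply: cvert_inj; rewrite /= act_src component_act.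
Qed.
Next Obligation. by move=> g f; apply: cedge_inj; rewrite /= act_bar. Qed.

End Collapse.

Definition giso (G : groupType) (X Y : ggraph G) : Prop :=
  exists (fv : vert X -> vert Y) (fe : edge X -> edge Y),
    [/\ bijective fv /\ bijective fe,
        forall e, src (fe e) = fv (src e),
        forall e, bar (fe e) = fe (bar e),
        forall g x, fv (actv g x) = actv g (fv x)
      & forall g e, fe (acte g e) = acte g (fe e)].

Record gtree (G : groupType) := GTree {
  gtree_graph :> ggraph G;
  gtree_tree : is_tree gtree_graph;
  gtree_noinv : without_inversions gtree_graph
}.

Section DeformationSpace.
Variable G : groupType.
Implicit Types (X Y Z T : gtree G) (D : gtree G -> Prop).

(* [Y = X_e]; equality of [G]-trees is equivariant isomorphism. *)
Definition is_collapse (X : ggraph G) (e : edge X) (Y : ggraph G) : Prop :=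
  geom_collapsible e /\ giso (collapse e) Y.

(* Collapse [e], then [f]; [cedge_of nef] is the image of [f] in [X_e]. *)
Definition is_collapse_then (X : ggraph G) (e f : edge X) (Y : ggraph G) :
    Prop :=
  geom_collapsible e /\
  exists nef : ~ same_geom e f,
    @is_collapse (collapse e) (cedge_of nef) Y.

(* [Y = X_{e u f}] *)
Definition is_collapse2 (X : ggraph G) (e f : edge X) (Y : ggraph G) : Prop :=
  is_collapse_then e f Y \/ is_collapse_then f e Y.

Definition collapse_move X Y : Prop := exists e : edge X, is_collapse e Y.

Definition deformation_space T : gtree G -> Prop :=
  clos_refl_sym_trans (gtree G)
    (fun X Y => giso X Y \/ collapse_move X Y) T.

Definition whitehead_I D X Y : Prop :=
  exists Z, D Z /\ exists e e' : edge Z,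
    [/\ ~ same_geom e e', is_collapse e X & is_collapse e' Y].

Definition whitehead_II D X Y : Prop :=
  exists Z, D Z /\ exists e e' f' : edge Z,
    [/\ [/\ ~ same_geom e e', ~ same_geom e f' & ~ same_geom e' f'],
        is_collapse e X & is_collapse2 e' f' Y].

Definition whitehead_move D X Y : Prop :=
  [/\ D X /\ reduced X, D Y /\ reduced Y
    & [\/ whitehead_I D X Y, whitehead_I D Y X,
          whitehead_II D X Y | whitehead_II D Y X]].

(* The empty sequence relates [X] and [Y] when they are the same [G]-tree,
   that is, equivariantly isomorphic. *)
Inductive whitehead_related D : gtree G -> gtree G -> Prop :=
| whitehead_nil X Y : giso X Y -> whitehead_related D X Y
| whitehead_cons X Y Z :
    whitehead_move D X Y -> whitehead_related D Y Z -> whitehead_related D X Z.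

End DeformationSpace.

(* Main.v *)
Require Import Defs.
From mathcomp Require Import all_boot.
From mathcomp Require Import boolp classical_sets.
From Stdlib Require Import Relations.
From Stdlib Require List.

(** Whether an edge of a marked graph can be collapsed depends only on the
    arrows of the quotient graph: put an arrow at the origin of [e] when
    [G_e = G_(o e)]. Collapsing [e] along its arrow merges its end points and
    keeps an arrow of another edge [f] leaving [o e] only if [e] also has an
    arrow at its other end. Hence two geometrically collapsible edges [e] and
    [f] can be collapsed one after the other, in either order and with the same
    result, unless they have the same two end points, or each of them has a
    single arrow and both arrows leave the same vertex ([compatP]). In these two
    cases they are in conflict.

    Two facts reduce the theorem to a local statement. Each collapse lowers the
    number of vertices that a collapsible edge leaves, and each expansion raises
    it by at most two ([rank_collapse], [rank_expand]). This number is 0 for a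
    reduced tree, so it is finite on all of the deformation space, and every
    tree there collapses to reduced ones in finitely many steps. Along a
    sequence of moves from [X] to [Y], consecutive trees have a common reduced
    descendant. It remains to see that all reduced descendants of a tree [Z] are
    related by Whitehead moves ([descends_related]); this goes by induction on
    the rank of [Z].

    By induction the descendants of each collapse [Z_e] are related. Say that
    [e] and [f] have the same descent when those of [Z_e] and [Z_f] are related
    too. Edges that are not in conflict have a common collapse, hence the same
    descent. Suppose that [e] and [f] do not have the same descent. If [Z_e] and
    [Z_f] are both reduced, they differ by a type I move, a contradiction. So,
    up to symmetry, [Z_e] has a further collapse [Z_{e u h}], and [f] is in
    conflict with both [e] and [h]. The two kinds of conflict are each
    transitive, so [f] is parallel to one of [e], [h] and leaves the same vertex
    as the other ([conflict_compat]). This leaves no room for a third edge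
    compatible with [e] and [h] ([conflict_triangle]) or for one compatible with
    [f] ([conflict_square]). Hence [Z_{e u h}] and [Z_f] are reduced, and they
    differ by a type II move, again a contradiction. *)

Set Implicit Arguments.
Unset Strict Implicit.
Unset Printing Implicit Defensive.

Local Open Scope group_scope.
Local Open Scope classical_set_scope.

(** * Walks and orbits *)

Section Walks.
Variables (G : groupType) (X : ggraph G).
Implicit Types (S : set (edge X)) (x y z : vert X) (e f : edge X).
Implicit Types (p q : seq (edge X)) (g : G).

Lemma walk_cat S x p y q z :
  walk S x p y -> walk S y q z -> walk S x (p ++ q) z.
Proof.
elim: p x => [x -> //|e p IH x /= [Se xe wp] wq].
by split=> //; apply: IH.
Qed.

Lemma walk_sub S S' x p y : S `<=` S' -> walk S x p y -> walk S' x p y.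
Proof.
move=> SS'; elim: p x => //= e p IH x [Se xe wp].
by split=> //; [apply: SS'|apply: IH].
Qed.

Lemma walk_rev S x p y : (forall e, S e -> S (bar e)) ->
  walk S x p y -> exists q, walk S y q x.
Proof.
move=> Sbar; elim: p x => [x ->|e p IH x /= [Se <- /IH[q wq]]].
  by exists [::].
exists (q ++ [:: bar e]); apply: walk_cat wq _ => /=.
by rewrite src_bar tgt_bar; split=> //; apply: Sbar.
Qed.

Lemma walk_reduce S x p y :
  walk S x p y -> exists2 q, walk S x q y & no_backtrack q.
Proof.
elim: p x => [x ->|e p IH x /= [Se xe /IH[q wq nq]]]; first by exists [::].
case: q wq nq => [|f q] wq nq; first by exists [:: e].
have [fe|fe] := pselect (f = bar e); last by exists [:: e, f & q].
exists q; last by case: nq.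
by case: wq => _ _; rewrite fe tgt_bar xe.
Qed.

(** A reduced walk inside [S] cannot cancel against an edge outside [S]. *)
Lemma no_backtrack_cat S x p y f q : (forall e, S e -> S (bar e)) ->
  walk S x p y -> no_backtrack p -> ~ S f -> no_backtrack (f :: q) ->
  no_backtrack (p ++ f :: q).
Proof.
move=> Sbar + + nSf nfq; elim: p x => //= e p IH x [Se _ wp] [np np'].
split; last by apply: IH wp np'.
by case: p np {IH wp np'} => //= _ fe; apply: nSf; rewrite fe; apply: Sbar.
Qed.

Lemma orbit_refl x : same_orbitv x x.
Proof. by exists 1; rewrite actv1. Qed.

Lemma orbit_sym x y : same_orbitv x y -> same_orbitv y x.
Proof. by case=> g ->; exists g^-1; rewrite -actvM mulVg actv1. Qed.

Lemma orbit_trans x y z :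
  same_orbitv x y -> same_orbitv y z -> same_orbitv x z.
Proof. by case=> g -> [h ->]; exists (h * g); rewrite actvM. Qed.

Lemma orbit_act x g : same_orbitv x (actv g x).
Proof. by exists g. Qed.

Lemma same_geom_refl e : same_geom e e.
Proof. by exists 1; left; rewrite acte1. Qed.

Lemma same_geom_sym e f : same_geom e f -> same_geom f e.
Proof.
by case=> g [->|->]; exists g^-1; [left|right];
  rewrite ?act_bar ?barK -acteM mulVg acte1.
Qed.

Lemma same_geom_trans e f h : same_geom e f -> same_geom f h -> same_geom e h.
Proof.
by move=> ef [g [->|->]]; rewrite same_geom_act // same_geom_bar.
Qed.

Lemma same_geom_eq e f : same_geom e f -> same_geom e = same_geom f.
Proof.
move=> ef; apply/seteqP; split=> h eh; last exact: same_geom_trans ef eh.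
exact: same_geom_trans (same_geom_sym ef) eh.
Qed.

End Walks.

(** * Equivariant isomorphisms *)

Section Giso.
Variable G : groupType.
Implicit Types X Y Z : ggraph G.

Definition is_giso X Y (fv : vert X -> vert Y) (fe : edge X -> edge Y) : Prop :=
  [/\ bijective fv /\ bijective fe,
      forall e, src (fe e) = fv (src e),
      forall e, bar (fe e) = fe (bar e),
      forall g x, fv (actv g x) = actv g (fv x)
    & forall g e, fe (acte g e) = acte g (fe e)].

Lemma is_giso_ex X Y fv fe : @is_giso X Y fv fe -> giso X Y.
Proof. by exists fv, fe. Qed.

Lemma giso_refl X : giso X X.
Proof. by exists id, id; split=> //; split; exists id. Qed.

Lemma is_giso_sym X Y fv fe : @is_giso X Y fv fe ->
  exists fv' fe', [/\ @is_giso Y X fv' fe', cancel fv' fv & cancel fe' fe].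
Proof.
move=> [[[fv' fvK fvK'] [fe' feK feK']] hs hb hv he].
exists fv', fe'; split=> //; split=> [|e|e|g x|g e].
- by split; [exists fv|exists fe].
- by rewrite -[in RHS](feK' e) hs fvK.
- by rewrite -[in RHS](feK' e) hb feK.
- by rewrite -[in LHS](fvK' x) -hv fvK.
- by rewrite -[in LHS](feK' e) -he feK.
Qed.

Lemma giso_sym X Y : giso X Y -> giso Y X.
Proof.
by move=> [fv [fe /is_giso_sym[fv' [fe' [YX _ _]]]]]; exists fv', fe'.
Qed.

Lemma giso_trans X Y Z : giso X Y -> giso Y Z -> giso X Z.
Proof.
move=> [fv [fe [[bv be] hs hb hv he]]] [fv' [fe' [[bv' be'] hs' hb' hv' he']]].
exists (fv' \o fv), (fe' \o fe); split=> [|e|e|g x|g e] /=.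
- by split; apply: bij_comp.
- by rewrite hs' hs.
- by rewrite hb' hb.
- by rewrite hv hv'.
- by rewrite he he'.
Qed.

End Giso.

(** * Quotients by a subgraph *)

Section Quotient.
Variable G : groupType.

(** The collapse of the edges in [S], up to isomorphism. The edges are described
    by the injection [i] that lifts an edge of the quotient to [X], because an
    edge of [S] has no image in [Y]. *)
Record is_quot (X : ggraph G) (S : set (edge X)) (Y : ggraph G)
    (pv : vert X -> vert Y) (i : edge Y -> edge X) : Prop := IsQuot {
  quot_surj : forall y, exists x, pv x = y;
  quot_fiber : forall x y, pv x = pv y <-> exists p, walk S x p y;
  quot_inj : injective i;
  quot_im : forall f, ~ S f <-> exists h, i h = f;
  quot_src : forall h, src h = pv (src (i h));
  quot_bar : forall h, i (bar h) = bar (i h);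
  quot_actv : forall g x, pv (actv g x) = actv g (pv x);
  quot_acte : forall g h, i (acte g h) = acte g (i h)
}.

Lemma quot_tgt X S Y pv i (q : @is_quot X S Y pv i) h :
  tgt h = pv (tgt (i h)).
Proof. by rewrite -!src_bar (quot_src q) (quot_bar q). Qed.

Lemma quot_map X S Y pv i Y' pv' i' :
  @is_quot X S Y pv i -> @is_quot X S Y' pv' i' ->
  exists (fv : vert Y -> vert Y') (fe : edge Y -> edge Y'),
    (forall x, fv (pv x) = pv' x) /\ (forall h, i' (fe h) = i h).
Proof.
move=> q q'.
have [fv fvP] := choice (quot_surj q).
have hi h : exists h', i' h' = i h.
  by apply/(quot_im q'); apply/(quot_im q); exists h.
have [fe feP] := choice hi.
exists (pv' \o fv), fe; split=> // x /=.
by apply/(quot_fiber q'); apply/(quot_fiber q).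
Qed.

(** The last clause lets the isomorphism be used to follow individual edges. *)
Lemma quot_uniq X S Y pv i Y' pv' i' :
  @is_quot X S Y pv i -> @is_quot X S Y' pv' i' ->
  exists fv fe, @is_giso G Y Y' fv fe /\ forall h, i' (fe h) = i h.
Proof.
move=> q q'.
have [fv [fe [hv he]]] := quot_map q q'.
have [fv' [fe' [hv' he']]] := quot_map q' q.
exists fv, fe; split=> //; split=> [|h|h|g y|g h].
- split; [exists fv'|exists fe'] => [y|y|h|h].
  + by have [x <-] := quot_surj q y; rewrite hv hv'.
  + by have [x <-] := quot_surj q' y; rewrite hv' hv.
  + by apply: (quot_inj q); rewrite he' he.
  + by apply: (quot_inj q'); rewrite he he'.
- by rewrite (quot_src q') he (quot_src q) hv.
- by apply: (quot_inj q'); rewrite (quot_bar q') !he (quot_bar q).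
- have [x <-] := quot_surj q y.
  by rewrite -(quot_actv q) !hv (quot_actv q').
- by apply: (quot_inj q'); rewrite (quot_acte q') !he (quot_acte q).
Qed.

Lemma quot_giso X S Y pv i Y' pv' i' :
  @is_quot X S Y pv i -> @is_quot X S Y' pv' i' -> giso Y Y'.
Proof. by move=> q /(quot_uniq q)[fv [fe [YY' _]]]; exists fv, fe. Qed.

Lemma quot_comp X S Y pv i S' Y' pv' i' :
  @is_quot X S Y pv i -> @is_quot Y S' Y' pv' i' ->
  is_quot [set f | S f \/ exists2 h, S' h & i h = f] (pv' \o pv) (i \o i').
Proof.
move=> q q'; split=> [y|x y|h h'|f|h|h|g x|g h] /=.
- have [y' <-] := quot_surj q' y; have [x <-] := quot_surj q y'.
  by exists x.
- split=> [/(quot_fiber q')[p]|[p]].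
    elim: p x => [x /= /(quot_fiber q)[p wp]|h p IH x /= [Sh + wp]].
      by exists p; apply: walk_sub wp => f; left.
    rewrite (quot_src q) => /esym/(quot_fiber q)[p1 wp1].
    have [|p2 wp2] := IH (tgt (i h)); first by rewrite -(quot_tgt q).
    exists (p1 ++ i h :: p2); apply: (@walk_cat _ _ _ _ _ (src (i h))).
      by apply: walk_sub wp1 => f; left.
    by split=> //; right; exists h.
  elim: p x => [x -> //|f p IH x /= [Sf <- /IH <-]].
  case: Sf => [Sf|[h Sh <-]].
    by congr pv'; apply/(quot_fiber q); exists [:: f].
  rewrite -(quot_src q) -(quot_tgt q).
  by apply/(quot_fiber q'); exists [:: h].
- by move/(quot_inj q)/(quot_inj q').
- split=> [nSf|[h <-] []].
  + have /(quot_im q)[h hf]: ~ S f by move=> Sf; apply: nSf; left.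
    have /(quot_im q')[h' h'h]: ~ S' h.
      by move=> Sh; apply: nSf; right; exists h.
    by exists h'; rewrite h'h.
  + by apply/(quot_im q); exists (i' h).
  + move=> [h' Sh' /(quot_inj q) h'h]; move: Sh'.
    by apply/(quot_im q'); exists h.
- by rewrite (quot_src q') (quot_src q).
- by rewrite (quot_bar q') (quot_bar q).
- by rewrite (quot_actv q) (quot_actv q').
- by rewrite (quot_acte q') (quot_acte q).
Qed.

Lemma component_eq (X : ggraph G) (e : edge X) x y :
  component e x = component e y <-> exists p, walk (same_geom e) x p y.
Proof.
have sym f : same_geom e f -> same_geom e (bar f) by rewrite same_geom_bar.
split=> [exy|[p wp]].
  by rewrite -[exists p, _]/(component e x y) exy; exists [::].
have [p' wp'] := walk_rev sym wp.
apply/seteqP; split=> z [r wr].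
  by exists (p' ++ r); apply: walk_cat wp' wr.
by exists (p ++ r); apply: walk_cat wp wr.
Qed.

Lemma cproj_eq (X : ggraph G) (e : edge X) x y :
  cproj e x = cproj e y <-> component e x = component e y.
Proof. by split=> [/(congr1 sval)|?] //; apply: cvert_inj. Qed.

Lemma cproj_act (X : ggraph G) (e : edge X) g x :
  cproj e (actv g x) = actv g (cproj e x : vert (collapse e)).
Proof. by apply: cvert_inj; rewrite /= component_act. Qed.

Lemma cproj_surj (X : ggraph G) (e : edge X) (A : vert (collapse e)) :
  exists x, cproj e x = A.
Proof. by case: A => A [x Ax]; exists x; apply: cvert_inj. Qed.

Lemma quot_collapse (X : ggraph G) (e : edge X) :
  @is_quot X (same_geom e) (collapse e) (cproj e)
    (fun f : edge (collapse e) => sval f).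
Proof.
split=> //.
- exact: cproj_surj.
- by move=> x y; rewrite cproj_eq component_eq.
- exact: cedge_inj.
- by move=> f; split=> [nef|[[h nh] <-]] //; exists (cedge_of nef).
- exact: cproj_act.
Qed.

(** Both sides are the quotient of [X] by the orbit of [e]: an isomorphism is
    itself a quotient, by the empty set of edges. *)
Lemma collapse_giso (X Y : ggraph G) fv fe (e : edge X) :
  @is_giso G X Y fv fe -> giso (collapse e) (collapse (fe e)).
Proof.
move=> [[[fv' fvK fvK'] [fe' feK feK']] hs hb hv he].
have qXY : @is_quot X set0 Y fv fe'.
  split=> [y|x y||f|h|h|g x|g h].
  - by exists (fv' y).
  - split=> [/(can_inj fvK) ->|[[|f p] /=]]; first by exists [::].
      by move=> ->.
    by case.
  - exact: can_inj feK'.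
  - by split=> [_|_ []]; exists (fe f).
  - by rewrite -hs feK'.
  - by rewrite -{1}(feK' h) hb feK.
  - by rewrite hv.
  - by rewrite -{1}(feK' h) -he feK.
have := quot_comp qXY (quot_collapse (fe e)).
apply: quot_giso.
suff -> : [set f | set0 f \/ (exists2 h, same_geom (fe e) h & fe' h = f)]
  = same_geom e by exact: quot_collapse.
apply/seteqP; split=> f /=.
  case=> // -[_ [g [->|->]] <-]; exists g; rewrite ?hb -he feK.
    by left.
  by right.
move=> [g [->|->]]; right.
  by exists (fe (acte g e)) => //; exists g; left.
by exists (fe (acte g (bar e))) => //; exists g; right; rewrite he hb.
Qed.

Lemma collapse_same_geom (X : ggraph G) (e f : edge X) :
  same_geom e f -> giso (collapse e) (collapse f).
Proof.
move=> /same_geom_eq ef; apply: quot_giso (quot_collapse e) _.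
by rewrite ef; apply: quot_collapse.
Qed.

Lemma quot_collapse2 (X : ggraph G) (e f : edge X) (nef : ~ same_geom e f) :
  @is_quot X [set h | same_geom e h \/ same_geom f h]
    (collapse (cedge_of nef : edge (collapse e)))
    (fun x => cproj (cedge_of nef : edge (collapse e))
                (cproj e x : vert (collapse e)))
    (fun h => sval (sval h)).
Proof.
set ef : edge (collapse e) := cedge_of nef.
suff -> : [set h | same_geom e h \/ same_geom f h] =
    [set h | same_geom e h \/ exists2 k, same_geom ef k & sval k = h].
  exact: quot_comp (quot_collapse e) (quot_collapse ef).
apply/seteqP; split=> h /=; last first.
  by case=> [|[k [g [->|->]] <-]]; [left|right; exists g; left
    |right; exists g; right].
have [eh|neh] := pselect (same_geom e h); first by left.
case=> [|[g fh]]; first by left.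
right; exists (cedge_of neh) => //; exists g.
by case: fh => fh; [left|right]; apply: cedge_inj.
Qed.

(** Both orders give the quotient of [X] by the union of the two orbits. *)
Lemma collapseC (X : ggraph G) (e f : edge X)
    (nef : ~ same_geom e f) (nfe : ~ same_geom f e) :
  exists fv fe,
    @is_giso G (collapse (cedge_of nef : edge (collapse e)))
      (collapse (cedge_of nfe : edge (collapse f))) fv fe /\
    forall h, sval (sval (fe h)) = sval (sval h).
Proof.
have q2 := quot_collapse2 nfe.
have SE : [set h | same_geom f h \/ same_geom e h] =
    [set h | same_geom e h \/ same_geom f h].
  by apply/seteqP; split=> h /=; tauto.
rewrite SE in q2.
by have [fv [fe H]] := quot_uniq (quot_collapse2 nef) q2; exists fv, fe.
Qed.

End Quotient.

(** * Collapsing a tree gives a tree *)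

Section CollapseTree.
Variable G : groupType.

(** Consecutive edges of a walk in the collapse are joined, in [X], by reduced
    walks inside the collapsed subgraph. The last conclusion is the induction
    hypothesis that excludes a backtrack where a new edge is put in front. *)
Lemma walk_lift (X : ggraph G) (e : edge X) (p : seq (edge (collapse e))) x y :
  walk setT (cproj e x : vert (collapse e)) p (cproj e y) -> no_backtrack p ->
  exists q, [/\ walk setT x q y, no_backtrack q, q = [::] -> p = [::]
    & if q is h :: _ then
        same_geom e h \/ exists f p', p = f :: p' /\ h = sval f
      else True].
Proof.
have sym f : same_geom e f -> same_geom e (bar f) by rewrite same_geom_bar.
elim: p x => [x|f p IH x] /=.
  move=> /cproj_eq/component_eq[p /walk_reduce[q wq nq]] _.
  exists q; split=> //; first by apply: walk_sub wq.
  by case: q wq {nq} => //= h q [eh _ _]; left.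
move=> [_ /cproj_eq/esym/component_eq[p0 /walk_reduce[q0 wq0 nq0]] wp] [nfp np].
have [q [wq nq _ hq]] := IH _ wp np.
have nfq : no_backtrack (sval f :: q).
  split=> //; case: q hq {wq nq} => // h q [eh hf|].
    apply: (svalP f); rewrite -same_geom_bar -hf; exact: eh.
  move=> [f' [p' [pf' ->]]] ff'; rewrite pf' in nfp.
  by apply: nfp; apply: cedge_inj.
exists (q0 ++ sval f :: q); split.
- apply: walk_cat (_ : walk setT x q0 (src (sval f))) _ => //.
  exact: walk_sub wq0.
- exact: no_backtrack_cat wq0 nq0 (svalP f) nfq.
- by case: (q0).
- case: q0 wq0 {nq0} => [_|h q0 [eh _ _]] /=; last by left.
  by right; exists f, p.
Qed.

Lemma collapse_tree (X : ggraph G) (e : edge X) :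
  is_tree X -> is_tree (collapse e).
Proof.
move=> [[x0 _] conn acyc]; split; first by exists (cproj e x0).
  move=> A B; have [x <-] := cproj_surj A; have [y <-] := cproj_surj B.
  have [p] := conn x y.
  elim: p x => [x ->|f p IH x /= [_ <- /IH[q wq]]]; first by exists [::].
  have [ef|nef] := pselect (same_geom e f).
    exists q; suff -> : cproj e (src f) = cproj e (tgt f) by [].
    by apply/cproj_eq/component_eq; exists [:: f].
  by exists ((cedge_of nef : edge (collapse e)) :: q).
move=> A p; have [x <-] := cproj_surj A => wp np.
have [q [wq nq qp _]] := walk_lift wp np.
by apply: qp; apply: acyc wq nq.
Qed.

Lemma collapse_noinv (X : ggraph G) (e : edge X) :
  without_inversions X -> without_inversions (collapse e).
Proof. by move=> noinv g f /(congr1 sval) /noinv. Qed.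

Definition collapse_gtree (Z : gtree G) (e : edge Z) : gtree G :=
  GTree (@collapse_tree Z e (gtree_tree Z))
    (@collapse_noinv Z e (@gtree_noinv _ Z)).

End CollapseTree.

(** * Collapsible edges of a collapse *)

Section Edges.
Variables (G : groupType) (X : ggraph G).
Implicit Types (x y : vert X) (e f : edge X) (g : G).

Definition full e : Prop := stabe e = stabv (src e).

(** In the quotient graph this is the set of end points of [e]; as a set of
    vertices of [X] it is a union of two orbits. *)
Definition ends e : set (vert X) :=
  [set x | same_orbitv (src e) x \/ same_orbitv (tgt e) x].

Lemma stabe_bar e : stabe (bar e) = stabe e.
Proof.
apply/seteqP; split=> g /=; rewrite /stabe /= -act_bar; last by move=> ->.
by move/(congr1 (@bar _ X)); rewrite !barK.
Qed.

Lemma ends_bar e : ends (bar e) = ends e.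
Proof.
by apply/seteqP; split=> x; rewrite /ends /= src_bar tgt_bar; tauto.
Qed.

Lemma stabv_act g x y :
  stabv (actv g x) = stabv (actv g y) <-> stabv x = stabv y.
Proof.
have H h x' y' :
    stabv x' = stabv y' -> stabv (actv h x') `<=` stabv (actv h y').
  move=> /seteqP[xy _] k; rewrite /stabv /= => kx.
  have /xy : stabv x' (h^-1 * k * h).
    by rewrite /stabv /= !actvM kx -actvM mulVg actv1.
  rewrite /stabv /= !actvM => {2}<-.
  by rewrite -[in RHS]actvM mulgV actv1.
have H' h x' y' :
    stabv x' = stabv y' -> stabv (actv h x') = stabv (actv h y').
  by move=> xy; apply/seteqP; split; apply: H.
split; last exact: H'.
by move=> /(H' g^-1); rewrite -!actvM mulVg !actv1.
Qed.

Lemma stabe_src e : stabe e `<=` stabv (src e).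
Proof. by move=> g; rewrite /stabe /stabv /= -act_src => ->. Qed.

Lemma ends_two e x y : ends e x -> ends e y -> ~ same_orbitv x y ->
  ends e = [set z | same_orbitv x z \/ same_orbitv y z].
Proof.
have join a u v : same_orbitv a u -> same_orbitv a v -> same_orbitv u v.
  by move=> /orbit_sym; apply: orbit_trans.
move=> [ex|ex] [ey|ey] nxy; last by case: nxy; apply: join ex ey.
- by case: nxy; apply: join ex ey.
- apply/seteqP; split=> z [h|h]; [left|right|left|right].
  + exact: join ex h.
  + exact: join ey h.
  + exact: orbit_trans ex h.
  + exact: orbit_trans ey h.
- apply/seteqP; split=> z [h|h]; [right|left|right|left].
  + exact: join ey h.
  + exact: join ex h.
  + exact: orbit_trans ex h.
  + exact: orbit_trans ey h.
Qed.

(** For collapsible [e], every translate of [src e] has a single collapsed edge,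
    and [retr e] moves it along that edge. The components of the collapsed
    subgraph are thus stars, whose centres are the fixed points of [retr e]: the
    vertices of the collapse may be replaced by the image of [retr e]. *)
Definition retr e x : vert X :=
  if pselect (same_orbitv (src e) x) is left P then actv (sval (cid P)) (tgt e)
  else x.

Section CollapsibleEdge.
Variable e : edge X.
Hypothesis ce : collapsible e.

Lemma retr_src g : retr e (actv g (src e)) = actv g (tgt e).
Proof.
rewrite /retr; case: pselect => [P|]; last by case; exists g.
case: cid => h /= gh; have [fe _] := ce.
have /= : stabv (src e) (g^-1 * h).
  by rewrite /stabv /= actvM -gh -actvM mulVg actv1.
rewrite -fe -stabe_bar => /stabe_src; rewrite /stabv /= src_bar.
by move/(congr1 (actv g)); rewrite -actvM mulVKg.
Qed.

Lemma retr_id x : ~ same_orbitv (src e) x -> retr e x = x.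
Proof. by rewrite /retr; case: pselect. Qed.

Lemma retr_tgt g : retr e (actv g (tgt e)) = actv g (tgt e).
Proof.
apply: retr_id => h; case: ce => _; apply.
exact: orbit_trans h (orbit_sym (orbit_act _ _)).
Qed.

Lemma retr_act g x : retr e (actv g x) = actv g (retr e x).
Proof.
have [[h ->]|nx] := pselect (same_orbitv (src e) x).
  by rewrite -actvM !retr_src actvM.
rewrite !retr_id // => h; apply: nx.
exact: orbit_trans h (orbit_sym (orbit_act _ _)).
Qed.

Lemma retr_component x y :
  component e x = component e y <-> retr e x = retr e y.
Proof.
split=> [/component_eq[p]|xy].
  elim: p x => [x -> //|f p IH x /= [[g ef] <- /IH <-]].
  case: ef => ->; rewrite ?act_src ?act_tgt ?src_bar ?tgt_bar.
    by rewrite retr_src retr_tgt.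
  by rewrite retr_src retr_tgt.
have comp z : component e z = component e (retr e z).
  have [[g ->]|nz] := pselect (same_orbitv (src e) z); last by rewrite retr_id.
  rewrite retr_src; apply/component_eq; exists [:: acte g e].
  by rewrite /= act_src act_tgt; split=> //; exists g; left.
by rewrite comp xy -comp.
Qed.

Lemma retr_orbit x y : (exists g, retr e y = actv g (retr e x)) <->
  same_orbitv x y \/ ends e x /\ ends e y.
Proof.
split=> [[g]|[[g ->]|]].
- rewrite -retr_act => H.
  have [[h xh]|nx] := pselect (same_orbitv (src e) x);
  have [[k yk]|ny] := pselect (same_orbitv (src e) y).
  + by right; split; left; [exists h|exists k].
  + right; split; first by left; exists h.
    right; rewrite (retr_id ny) in H; rewrite H xh -actvM retr_src.
    exact: orbit_act.
  + right; split; last by left; exists k.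
    right; rewrite yk retr_src retr_act (retr_id nx) in H.
    exists (g^-1 * k); rewrite actvM H -actvM mulVg actv1 //.
  + left; exists g; rewrite (retr_id ny) in H; rewrite H retr_act.
    by rewrite (retr_id nx).
- by exists g; rewrite retr_act.
- have ret z : ends e z -> exists g, retr e z = actv g (tgt e).
    by move=> [[g ->]|[g ->]]; exists g; rewrite ?retr_src ?retr_tgt.
  move=> [/ret[g ->] /ret[h ->]]; exists (h * g^-1).
  by rewrite -actvM mulgVK.
Qed.

End CollapsibleEdge.

Definition orients e f : Prop := f = e \/ f = bar e.

Lemma orients_geom e f : orients e f -> same_geom e = same_geom f.
Proof.
move=> ef; apply: same_geom_eq; exists 1.
by case: ef => ->; [left|right]; rewrite acte1.
Qed.

Lemma orients_ends e f : orients e f -> ends f = ends e.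
Proof. by case=> -> //; rewrite ends_bar. Qed.

Lemma gcoll_orients e :
  geom_collapsible e <-> exists2 f, orients e f & collapsible f.
Proof.
split=> [[ce|ce]|[f [->|->] cf]].
- by exists e => //; left.
- by exists (bar e) => //; right.
- by left.
- by right.
Qed.

Section Collapsed.
Variables (e e0 : edge X).
Hypothesis (oe : orients e e0) (ce : collapsible e0).

Lemma component_orient : component e = component e0.
Proof. by rewrite /component (orients_geom oe). Qed.

Lemma cproj_retr x y : cproj e x = cproj e y <-> retr e0 x = retr e0 y.
Proof. by rewrite cproj_eq component_orient retr_component. Qed.

Lemma cproj_orbit x y :
  same_orbitv (cproj e x : vert (collapse e)) (cproj e y) <->
  same_orbitv x y \/ ends e x /\ ends e y.
Proof.
rewrite -(orients_ends oe) -(retr_orbit ce); split=> -[g].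
  by rewrite -cproj_act => /cproj_retr ->; exists g; rewrite retr_act.
move=> H; exists g; rewrite -cproj_act; apply/cproj_retr.
by rewrite retr_act.
Qed.

(** The stabilizer of the image of [src f] is that of [retr e0 (src f)]. If
    [src f] is a translate of [src e0], it equals [stabe f] exactly when both
    inclusions in [stabe f <= stabv (src f) <= stabv (retr e0 (src f))] are
    equalities, and the second one is conjugate to
    [stabe e0 <= stabv (tgt e0)]. *)
Lemma collapsible_collapse f (nef : ~ same_geom e f) :
  @collapsible _ (collapse e) (cedge_of nef) <->
  [/\ collapsible f, ends f <> ends e
    & same_orbitv (src e0) (src f) -> full (bar e0)].
Proof.
have stabE : @stabe _ (collapse e) (cedge_of nef) = stabe f.
  apply/seteqP; split=> g; first by move/(congr1 sval).
  by move=> gf; apply: cedge_inj.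
have stabV : @stabv _ (collapse e) (cproj e (src f)) = stabv (retr e0 (src f)).
  apply/seteqP; split=> g H.
    by rewrite /stabv /= -retr_act //; apply/cproj_retr; rewrite cproj_act.
  apply: etrans (esym (cproj_act e g (src f))) _.
  by apply/cproj_retr; rewrite retr_act.
have orbE : ~ same_orbitv (src f) (tgt f) /\ ends f <> ends e <->
    ~ @same_orbitv _ (collapse e) (cproj e (src f)) (cproj e (tgt f)).
  rewrite cproj_orbit; split=> [[nst nfe] [//|[es et]]|H].
    by apply: nfe; rewrite (ends_two es et nst).
  split=> [|fe]; first by tauto.
  by apply: H; right; rewrite -fe; split; [left|right]; apply: orbit_refl.
have fullE : full f /\ (same_orbitv (src e0) (src f) -> full (bar e0)) <->
    stabe f = stabv (retr e0 (src f)).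
  have [[g fg]|nf] := pselect (same_orbitv (src e0) (src f)); last first.
    by rewrite retr_id //; split=> [[]|].
  have fb : full (bar e0) <-> stabv (src f) = stabv (retr e0 (src f)).
    rewrite fg retr_src // stabv_act -ce.1 /full stabe_bar src_bar.
    by [].
  split=> [[ff /(_ (ex_intro _ g fg)) /fb <-] //|H].
  have le : stabv (src f) `<=` stabv (retr e0 (src f)).
    by move=> h; rewrite /stabv /= -retr_act // => ->.
  have ff : full f.
    apply/seteqP; split; first exact: stabe_src.
    by rewrite H.
  by split=> // _; apply/fb; rewrite -H ff.
rewrite /collapsible stabE [src _]/= [tgt _]/= stabV -orbE -fullE /full.
by split=> [[[? ?] [? ?]]|[[? ?] ? ?]].
Qed.

End Collapsed.

Lemma gcoll_collapse e f (nef : ~ same_geom e f) :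
  @geom_collapsible _ (collapse e) (cedge_of nef) <->
  exists2 f0, orients f f0 &
    exists nef0 : ~ same_geom e f0, @collapsible _ (collapse e) (cedge_of nef0).
Proof.
have nefb : ~ same_geom e (bar f) by rewrite same_geom_bar.
have barE : bar (cedge_of nef : edge (collapse e)) = cedge_of nefb.
  exact: cedge_inj.
rewrite /geom_collapsible barE; split=> [[cf|cf]|[f0 [->|->] [nef0]]].
- by exists f; [left|exists nef].
- by exists (bar f); [right|exists nefb].
- by rewrite (Prop_irrelevance nef0 nef); left.
- by rewrite (Prop_irrelevance nef0 nefb); right.
Qed.

(** In the quotient graph: [e] has a single arrow, and it leaves [x]. *)
Definition only_full e x : Prop :=
  exists f, [/\ orients e f, full f, ~ full (bar f) & same_orbitv (src f) x].

Definition clash e f : Prop := exists x, only_full e x /\ only_full f x.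

Lemma only_fullP e f x : orients e f -> full f ->
  only_full e x <-> ~ full (bar f) /\ same_orbitv (src f) x.
Proof.
move=> oef ff; split=> [[f' [oef' ff' nff' fx]]|[nff fx]]; last by exists f.
have [E|ff'E] : f' = f \/ f' = bar f.
  by case: oef oef' => -> [->|->]; rewrite ?barK; [left|right|right|left].
  by rewrite -E.
by case: nff'; rewrite ff'E barK.
Qed.

Lemma only_full_act e x y : only_full e x -> same_orbitv x y -> only_full e y.
Proof.
by move=> [f [oef ff nff fx]] xy; exists f; split=> //; apply: orbit_trans fx xy.
Qed.

Lemma only_full_orbit e x y :
  only_full e x -> only_full e y -> same_orbitv x y.
Proof.
move=> [f [oef ff nff fx]] /(only_fullP _ oef ff)[_]; apply: orbit_trans.
exact: orbit_sym.
Qed.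

Lemma only_full_ends e x : only_full e x -> ends e x.
Proof. by move=> [f [oef _ _ fx]]; rewrite -(orients_ends oef); left. Qed.

Lemma clash_sym e f : clash e f -> clash f e.
Proof. by move=> [x [ex fx]]; exists x. Qed.

Lemma clash_trans e f h : clash e f -> clash f h -> clash e h.
Proof.
move=> [x [ex fx]] [y [fy hy]]; exists x; split=> //.
exact: only_full_act hy (only_full_orbit fy fx).
Qed.

Definition compat e f : Prop :=
  geom_collapsible e /\
  exists nef : ~ same_geom e f, @geom_collapsible _ (collapse e) (cedge_of nef).

Lemma same_geom_ends e f : same_geom e f -> ends f = ends e.
Proof.
have H g e' : ends (acte g e') = ends e'.
  by apply/seteqP; split=> x; rewrite /ends /= act_src act_tgt => -[h|h];
    [left|right|left|right];
    by [apply: orbit_trans h; exact: orbit_act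
       |apply: orbit_trans h; apply: orbit_sym; exact: orbit_act].
by move=> [g [->|->]]; rewrite H ?ends_bar.
Qed.

(** Right to left, an orientation of [f] must be chosen: if the arrow of [f] at
    [src e0] does not survive, there is no clash, so [f] has an arrow at its
    other end too, and that one survives. *)
Lemma compatP e f : compat e f <->
  [/\ geom_collapsible e, geom_collapsible f, ends e <> ends f & ~ clash e f].
Proof.
split=> [[ge [nef]]|[ge gf nends ncl]].
  have [e0 oe ce] := (gcoll_orients e).1 ge.
  move=> /gcoll_collapse[f0 of_ [nef0 /(collapsible_collapse oe ce)[cf nends fb]]].
  split=> //; first by apply/gcoll_orients; exists f0.
    by move=> ef; apply: nends; rewrite (orients_ends of_).
  move=> [x [/(only_fullP _ oe ce.1)[nfe ex] /(only_fullP _ of_ cf.1)[nff fx]]].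
  by apply: nfe; apply: fb; apply: orbit_trans ex (orbit_sym fx).
split=> //; have nef : ~ same_geom e f by move/same_geom_ends/esym.
exists nef; apply/gcoll_collapse.
have [e0 oe ce] := (gcoll_orients e).1 ge.
have [f0 of_ cf] := (gcoll_orients f).1 gf.
have nef0 f1 : orients f f1 -> ~ same_geom e f1.
  by case=> ->; rewrite ?same_geom_bar.
have nends1 f1 : orients f f1 -> ends f1 <> ends e.
  by move/orients_ends->; exact/nesym.
have [ff|nff] := pselect (same_orbitv (src e0) (src f0) -> full (bar e0)).
  exists f0 => //; exists (nef0 _ of_).
  by apply/(collapsible_collapse oe ce); split=> //; apply: nends1.
have [e0f0 nfe] : same_orbitv (src e0) (src f0) /\ ~ full (bar e0).
  by move/not_implyP: nff.
have fb : full (bar f0).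
  apply: contrapT => nfb; apply: ncl; exists (src f0); split.
    exact/(only_fullP _ oe ce.1).
  by apply/(only_fullP _ of_ cf.1); split=> //; apply: orbit_refl.
have ofb : orients f (bar f0) by case: of_ => ->; [right|left; rewrite barK].
exists (bar f0) => //; exists (nef0 _ ofb).
have ncst := cf.2.
apply/(collapsible_collapse oe ce); split; [split=> //|exact: nends1|].
  by rewrite src_bar tgt_bar => /orbit_sym.
rewrite src_bar => H; case: ncst; exact: orbit_trans (orbit_sym e0f0) H.
Qed.

Lemma compat_sym e f : compat e f -> compat f e.
Proof.
move=> /compatP[ge gf ? cl].
by apply/compatP; split=> //; [exact/nesym|move/clash_sym].
Qed.

Definition conflict e f : Prop :=
  [/\ geom_collapsible e, geom_collapsible f & ~ compat e f].

Lemma conflictP e f : conflict e f -> ends e = ends f \/ clash e f.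
Proof.
move=> [ge gf nc]; have [|ne] := pselect (ends e = ends f); first by left.
by right; apply: contrapT => ncl; apply: nc; apply/compatP.
Qed.

(** Being parallel and clashing are both transitive, and [e], [h] are neither
    parallel nor in clash. *)
Lemma conflict_compat e h f : compat e h -> conflict e f -> conflict h f ->
  ends e = ends f /\ clash h f \/ ends h = ends f /\ clash e f.
Proof.
move=> /compatP[_ _ neh ncl] /conflictP[ef|ef] /conflictP[hf|hf].
- by case: neh; rewrite ef.
- by left.
- by right.
- by case: ncl; apply: clash_trans ef (clash_sym hf).
Qed.

(** By [conflict_compat] on each pair, [f] is parallel to one edge of each pair
    and clashes with the other. Among three edges, two are of the same kind. *)
Lemma conflict_triangle e h k f : compat e h -> compat e k -> compat h k ->
  conflict e f -> conflict h f -> conflict k f -> False.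
Proof.
move=> eh ek hk ef hf kf.
have /compatP[_ _ neh nceh] := eh.
have /compatP[_ _ nek ncek] := ek.
have /compatP[_ _ nhk nchk] := hk.
case: (conflict_compat eh ef hf) => -[E1 C1];
case: (conflict_compat ek ef kf) => -[E2 C2];
case: (conflict_compat hk hf kf) => -[E3 C3];
by [case: neh; rewrite E1|case: nek; rewrite E2|case: nhk; rewrite E3
   |case: nceh; apply: clash_trans (clash_sym _); eassumption
   |case: ncek; apply: clash_trans (clash_sym _); eassumption
   |case: nchk; apply: clash_trans (clash_sym _); eassumption].
Qed.

(** If [f] is parallel to [e] and clashes with [h], then [k] must be parallel to
    [h] and clash with [e]. So the arrow of [f], which leaves the same vertex as
    that of [h], and the arrow of [k], which leaves the same vertex as that of
    [e], start at common end points of all four edges: either at the same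
    vertex, and [f], [k] clash, or at different ones, and [f], [k] are
    parallel. *)
Lemma conflict_square e h f k : compat e h -> compat f k ->
  conflict e f -> conflict h f -> conflict e k -> conflict h k -> False.
Proof.
have csym u v : conflict u v -> conflict v u.
  by move=> [? ? nc]; split=> // /compat_sym.
wlog [ef hf] : e h / ends e = ends f /\ clash h f.
  move=> W eh fk ef hf ek hk; case: (conflict_compat eh ef hf) => H.
    exact: W H eh fk ef hf ek hk.
  exact: W H (compat_sym eh) fk hf ef hk ek.
move=> eh /[dup] fk /compatP[_ _ nfk ncfk] cef chf cek chk.
case: (conflict_compat fk (csym _ _ cef) (csym _ _ cek)) => -[E1 C1]; last first.
  by apply: nfk; rewrite E1 ef.
case: (conflict_compat fk (csym _ _ chf) (csym _ _ chk)) => -[E2 C2].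
  by have /compatP[_ _ + _] := eh; apply; rewrite ef.
have [v [kv ev]] := C1; have [w [hw fw]] := hf.
have [vw|nvw] := pselect (same_orbitv v w).
  by apply: ncfk; exists w; split=> //; apply: only_full_act kv vw.
have hv : ends h v by rewrite -E2; apply: only_full_ends.
have hw' : ends h w by apply: only_full_ends.
have fv : ends f v by rewrite -ef; apply: only_full_ends.
have fw' : ends f w by apply: only_full_ends.
by apply: nfk; rewrite E2 (ends_two hv hw' nvw) (ends_two fv fw' nvw).
Qed.

End Edges.

(** If [e], [h], [k] can be collapsed in this order, then [h] and [k] commute
    in the collapse of [e], so that [k] can be collapsed right after [e]. *)
Lemma compat_third (G : groupType) (X : ggraph G) (e h : edge X)
    (neh : ~ same_geom e h)
    (k : edge (collapse (cedge_of neh : edge (collapse e)))) :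
  geom_collapsible e -> @geom_collapsible _ (collapse e) (cedge_of neh) ->
  collapsible k -> compat e (sval (sval k)).
Proof.
move=> ge geh ck; split=> //; case: k ck => [[k nek] nhk] /= ck; exists nek.
suff /compat_sym[] :
    @compat _ (collapse e) (cedge_of neh) (cedge_of nek : edge (collapse e)).
  by [].
by split=> //; exists nhk; left.
Qed.

(** * Finiteness of descending sequences of collapses *)

Section Rank.
Variable G : groupType.
Implicit Types X Y : ggraph G.

Lemma collapsible_giso X Y fv fe (e : edge X) :
  @is_giso G X Y fv fe -> collapsible e -> collapsible (fe e).
Proof.
move=> [[[fv' fvK fvK'] [fe' feK feK']] hs hb hv he] [ee nst]; split.
  have stE g : stabe (fe e) g <-> stabe e g.
    by rewrite /stabe /= -he; split=> [/(can_inj feK)|->].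
  have svE g : stabv (src (fe e)) g <-> stabv (src e) g.
    by rewrite /stabv /= hs -hv; split=> [/(can_inj fvK)|->].
  by apply/seteqP; split=> g; rewrite stE svE ee.
move=> [g]; rewrite -!src_bar hb !hs -hv => /(can_inj fvK) H.
by apply: nst; exists g; rewrite -src_bar.
Qed.

Lemma gcoll_giso X Y fv fe (e : edge X) :
  @is_giso G X Y fv fe -> geom_collapsible e -> geom_collapsible (fe e).
Proof.
move=> XY [ce|ce]; first by left; apply: collapsible_giso XY ce.
by right; have [_ _ -> _ _] := XY; apply: collapsible_giso XY ce.
Qed.

(** At most [n] vertices of the quotient graph are the origin of a collapsible
    edge. The quotient graph itself may be infinite. *)
Definition rank_le n X : Prop :=
  exists s : seq (vert X), (size s <= n)%N /\
    forall e, collapsible e -> exists2 x, List.In x s & same_orbitv x (src e).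

Lemma rank_le0 X : rank_le 0 X <-> reduced X.
Proof.
split=> [[[|x s] [// _ H]] e /H[] //|rX].
by exists [::]; split=> // e ce; case: (rX e).
Qed.

Lemma rank_giso n X Y : giso X Y -> rank_le n X -> rank_le n Y.
Proof.
move=> [fv [fe XY]] [s [sn hs]].
have [fv' [fe' [YX fvK feK]]] := is_giso_sym XY.
exists [seq fv x | x <- s]; split=> [|f /(collapsible_giso YX)/hs[x sx [g xg]]].
  by rewrite size_map.
exists (fv x); first exact: List.in_map.
have [_ _ _ hv _] := XY; exists g.
by rewrite -hv -xg; have [_ -> _ _ _] := YX; rewrite fvK.
Qed.

Lemma reduced_giso X Y : giso X Y -> reduced X -> reduced Y.
Proof. by move=> XY /rank_le0/(rank_giso XY)/rank_le0. Qed.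

(** The orbit of [src e0] is lost: if a collapsible edge of the collapse comes
    from an edge leaving it, then [bar e0] is collapsible as well, and the orbit
    of [tgt e0] represents the merged vertex. *)
Lemma rank_collapse n X (e : edge X) :
  geom_collapsible e -> rank_le n.+1 X -> rank_le n (collapse e).
Proof.
move=> /gcoll_orients[e0 oe ce] [s [sn hs]].
have [x0 sx0 x0e] := hs _ ce.
have [s1 [s2 sE]] := List.in_split _ _ sx0.
have rest f : collapsible f -> ~ same_orbitv (src e0) (src f) ->
    exists2 x, List.In x (s1 ++ s2) & same_orbitv x (src f).
  move=> /hs[x sx xf] nef; exists x => //.
  move: sx; rewrite sE => /List.in_app_iff[s1x|[xE|s2x]].
  - by apply/List.in_app_iff; left.
  - case: nef; apply: orbit_trans (orbit_sym x0e) _; by rewrite xE.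
  - by apply/List.in_app_iff; right.
exists [seq (cproj e x : vert (collapse e)) | x <- s1 ++ s2]; split.
  by rewrite size_map; move: sn; rewrite sE !size_cat /= addnS.
move=> [f nef] /(collapsible_collapse oe ce)[cf nfe fb] /=.
have [ef|nsf] := pselect (same_orbitv (src e0) (src f)); last first.
  have [x sx xf] := rest _ cf nsf.
  exists (cproj e x); first exact: (List.in_map (cproj e)).
  by apply/(cproj_orbit oe ce); left.
have cb : collapsible (bar e0).
  split; first exact: fb.
  by rewrite src_bar tgt_bar => /orbit_sym; exact: ce.2.
have [|x sx xe] := rest _ cb; first by rewrite src_bar; exact: ce.2.
exists (cproj e x); first exact: (List.in_map (cproj e)).
apply/(cproj_orbit oe ce); right; rewrite -(orients_ends oe).
by split; [right; rewrite -src_bar; exact: orbit_sym|left].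
Qed.

(** An edge leaving neither end point of [e] keeps its stabilizers and remains
    collapsible after the collapse. *)
Lemma rank_expand n X (e : edge X) :
  geom_collapsible e -> rank_le n (collapse e) -> rank_le n.+2 X.
Proof.
move=> /gcoll_orients[e0 oe ce] [s [sn hs]].
have [rep repK] := choice (@cproj_surj _ X e).
exists [:: src e, tgt e & [seq rep A | A <- s]]; split.
  by rewrite /= size_map !ltnS.
move=> f cf; have [[ef|ef]|nef] := pselect (ends e (src f)).
- by exists (src e); [left|].
- by exists (tgt e); [right; left|].
have nends : ends f <> ends e.
  by move=> fe; apply: nef; rewrite -fe; left; apply: orbit_refl.
have ngeom : ~ same_geom e f by move/same_geom_ends.
have [|A sA Af] := hs (cedge_of ngeom).
  apply/(collapsible_collapse oe ce); split=> // ef.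
  by case: nef; rewrite -(orients_ends oe); left.
exists (rep A); first by right; right; apply: List.in_map.
by move: Af; rewrite -{1}(repK A) => /(cproj_orbit oe ce)[|[_ /nef]].
Qed.

Definition finite_rank X : Prop := exists n, rank_le n X.

Lemma finite_rank_giso X Y : giso X Y -> finite_rank X -> finite_rank Y.
Proof. by move=> XY [n /(rank_giso XY)]; exists n. Qed.

Lemma finite_rank_collapse X (e : edge X) :
  geom_collapsible e -> finite_rank (collapse e) <-> finite_rank X.
Proof.
move=> ge; split=> [[n /(rank_expand ge)]|[n [s [sn hs]]]]; first by exists n.+2.
by exists n; apply: rank_collapse ge _; exists s; split=> //; apply: leqW.
Qed.

End Rank.

(** * Reduced descendants *)

Section Descent.
Variable G : groupType.
Implicit Types Z A B : gtree G.

Inductive descends : gtree G -> gtree G -> Prop :=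
| descends_nil Z A : giso Z A -> reduced A -> descends Z A
| descends_cons Z (e : edge Z) A :
    geom_collapsible e -> descends (collapse_gtree e) A -> descends Z A.

Lemma descends_refl Z : reduced Z -> descends Z Z.
Proof. by apply: descends_nil; apply: giso_refl. Qed.

Lemma descends_giso Z Z' A : giso Z Z' -> descends Z A -> descends Z' A.
Proof.
move=> + ZA; elim: ZA Z' => {Z A} [Z A ZA rA|Z e A ge _ IH] Z' ZZ'.
  by apply: descends_nil => //; apply: giso_trans ZA; apply: giso_sym.
have [fv [fe XY]] := ZZ'.
apply: (descends_cons (gcoll_giso XY ge)); apply: IH.
exact: collapse_giso XY.
Qed.

Lemma descends_exists Z : finite_rank Z -> exists A, descends Z A.
Proof.
move=> [n]; elim: n Z => [|n IH] Z.
  by move=> /rank_le0 rZ; exists Z; apply: descends_refl.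
have [rZ _|/existsNP[e /contrapT ce]] := pselect (reduced Z).
  by exists Z; apply: descends_refl.
have ge : geom_collapsible e by left.
move=> /(rank_collapse ge) /(IH (collapse_gtree e))[A eA]; exists A.
exact: descends_cons eA.
Qed.

Lemma reduced_gcoll Z (e : edge Z) : reduced Z -> ~ geom_collapsible e.
Proof. by move=> rZ [/rZ|/rZ]. Qed.

Lemma descends_of_reduced Z A : reduced Z -> descends Z A -> giso Z A.
Proof.
by move=> + ZA; case: ZA => {Z A} // Z e A ge _ /reduced_gcoll /(_ ge).
Qed.

End Descent.

(** * Whitehead moves between the descendants of a tree *)

Section Whitehead.
Variables (G : groupType) (T : gtree G).
Local Notation D := (deformation_space T).
Local Notation related := (whitehead_related D).
Implicit Types X Y Z A B C : gtree G.

Lemma D_giso X Y : giso X Y -> D X -> D Y.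
Proof. by move=> XY DX; apply: rst_trans DX _; apply: rst_step; left. Qed.

Lemma D_collapse Z (e : edge Z) :
  geom_collapsible e -> D Z -> D (collapse_gtree e).
Proof.
move=> ge DZ; apply: rst_trans DZ _; apply: rst_step; right; exists e.
by split=> //; apply: giso_refl.
Qed.

Lemma whitehead_move_sym X Y : whitehead_move D X Y -> whitehead_move D Y X.
Proof.
by move=> [DX DY H]; split=> //; case: H => H;
  [apply: Or42|apply: Or41|apply: Or44|apply: Or43].
Qed.

Lemma whitehead_move_giso X X' Y :
  giso X X' -> whitehead_move D X Y -> whitehead_move D X' Y.
Proof.
move=> XX' [[DX rX] DY H].
have col Z (e : edge Z) : is_collapse e X -> is_collapse e X'.
  by move=> [ge eX]; split=> //; apply: giso_trans eX XX'.
have col_then Z (e f : edge Z) :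
    is_collapse_then e f X -> is_collapse_then e f X'.
  move=> [ge [nef [gf fX]]]; split=> //; exists nef; split=> //.
  exact: giso_trans fX XX'.
split=> //; first by split; [apply: D_giso XX' DX|apply: reduced_giso XX' rX].
case: H => -[Z [DZ]].
- move=> [e [e' [ne eX eY]]]; apply: Or41; exists Z; split=> //.
  by exists e, e'; split=> //; apply: col.
- move=> [e [e' [ne eX eY]]]; apply: Or42; exists Z; split=> //.
  by exists e, e'; split=> //; apply: col.
- move=> [e [e' [f [ne eX eY]]]]; apply: Or43; exists Z; split=> //.
  by exists e, e', f; split=> //; apply: col.
- move=> [e [e' [f [ne eX eY]]]]; apply: Or44; exists Z; split=> //.
  exists e, e', f; split=> //.
  by case: eY => eY; [left|right]; apply: col_then.
Qed.

Lemma related_trans X Y Z : related X Y -> related Y Z -> related X Z.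
Proof.
elim=> {X Y} [X Y XY YZ|X Y W XY _ IH /IH]; last exact: whitehead_cons.
case: YZ XY => {Y Z} [Y Z YZ|Y Z W YZ ZW] XY.
  by apply: whitehead_nil; apply: giso_trans XY YZ.
exact: whitehead_cons (whitehead_move_giso (giso_sym XY) YZ) ZW.
Qed.

Lemma related_move X Y : whitehead_move D X Y -> related X Y.
Proof.
move=> XY; apply: whitehead_cons XY _; apply: whitehead_nil; exact: giso_refl.
Qed.

Lemma related_sym X Y : related X Y -> related Y X.
Proof.
elim=> {X Y} [X Y /giso_sym|X Y Z XY _ ZY]; first exact: whitehead_nil.
exact: related_trans ZY (related_move (whitehead_move_sym XY)).
Qed.

Section Peak.
Variables (n : nat) (Z : gtree G).
Hypothesis (DZ : D Z) (rZ : rank_le n.+1 Z).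
Hypothesis IH : forall Z', D Z' -> rank_le n Z' ->
  forall A B, descends Z' A -> descends Z' B -> related A B.

Definition same_descent (e f : edge Z) : Prop :=
  forall A B, descends (collapse_gtree e) A ->
    descends (collapse_gtree f) B -> related A B.

Lemma same_descent_sym e f : same_descent e f -> same_descent f e.
Proof. by move=> H A B fA eB; apply: related_sym; apply: H. Qed.

Lemma same_descent_trans e f h : geom_collapsible f ->
  same_descent e f -> same_descent f h -> same_descent e h.
Proof.
move=> gf ef fh A B eA hB.
have [|C fC] := @descends_exists _ (collapse_gtree f).
  by exists n; apply: rank_collapse.
exact: related_trans (ef _ _ eA fC) (fh _ _ fC hB).
Qed.

Lemma same_descent_geom e f :
  geom_collapsible f -> same_geom e f -> same_descent e f.
Proof.
move=> gf ef A B eA fB; apply: (IH (D_collapse gf DZ)) fB.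
  exact: rank_collapse.
by apply: descends_giso eA; apply: collapse_same_geom.
Qed.

Lemma same_descent_compat e f : compat e f -> same_descent e f.
Proof.
move=> ef A B eA fB.
have [gf [nfe gfe]] := compat_sym ef.
have [ge [nef gef]] := ef.
have re := rank_collapse ge rZ.
pose Zef := collapse_gtree (cedge_of nef : edge (collapse_gtree e)).
pose Zfe := collapse_gtree (cedge_of nfe : edge (collapse_gtree f)).
have ZefE : giso Zef Zfe.
  by have [fv [fe [/is_giso_ex H _]]] := collapseC nef nfe.
have [|C efC] := @descends_exists _ Zef.
  by apply/(finite_rank_collapse gef); exists n.
have eC : descends (collapse_gtree e) C.
  exact: (@descends_cons _ (collapse_gtree e)) gef efC.
have fC : descends (collapse_gtree f) C.
  exact: (@descends_cons _ (collapse_gtree f)) gfe (descends_giso ZefE efC).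
apply: related_trans (IH (D_collapse ge DZ) re eA eC) _.
exact: IH (D_collapse gf DZ) (rank_collapse gf rZ) _ _ fC fB.
Qed.

Lemma not_same_descent e f : geom_collapsible e -> geom_collapsible f ->
  ~ same_descent e f -> conflict e f /\ ~ same_geom e f.
Proof.
move=> ge gf nef; split; first by split=> // /same_descent_compat.
by move/(same_descent_geom gf).
Qed.

(** One related pair suffices, as the descendants of each collapse are related
    to each other by the induction hypothesis. *)
Lemma same_descent_witness e f :
  geom_collapsible e -> geom_collapsible f ->
  (exists X Y, [/\ descends (collapse_gtree e) X,
    descends (collapse_gtree f) Y & related X Y]) ->
  same_descent e f.
Proof.
move=> ge gf [X [Y [eX fY XY]]] A B eA fB.
apply: related_trans (IH (D_collapse ge DZ) (rank_collapse ge rZ) eA eX) _.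
apply: related_trans XY _.
exact: IH (D_collapse gf DZ) (rank_collapse gf rZ) _ _ fY fB.
Qed.

Lemma same_descent_both_reduced e f :
  geom_collapsible e -> geom_collapsible f -> ~ same_geom e f ->
  reduced (collapse_gtree e) -> reduced (collapse_gtree f) -> same_descent e f.
Proof.
move=> ge gf nef re rf; apply: same_descent_witness => //.
exists (collapse_gtree e), (collapse_gtree f); split; [exact: descends_refl..|].
apply: related_move; split; [split=> //; exact: D_collapse..|].
apply: Or41; exists Z; split=> //; exists e, f.
by split=> //; split=> //; apply: giso_refl.
Qed.

(** Otherwise [f] is in conflict with [e], [h] and every edge that has the same
    descent as [e], which forces the configuration of a type II move. *)
Lemma same_descent_not_reduced e h f : compat e h -> geom_collapsible f ->
  same_descent e f.
Proof.
move=> eh gf; apply: contrapT => nef.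
have [ge [neh geh]] := eh; have [gh [nhe ghe]] := compat_sym eh.
have conf k : geom_collapsible k -> same_descent e k ->
    conflict k f /\ ~ same_geom k f.
  move=> gk ek; apply: not_same_descent => // kf.
  by apply: nef; apply: same_descent_trans ek kf.
have [cef nsef] := not_same_descent ge gf nef.
have [chf nshf] := conf _ gh (same_descent_compat eh).
pose Zeh := collapse_gtree (cedge_of neh : edge (collapse_gtree e)).
have rZeh : reduced Zeh.
  move=> k ck; have ek := compat_third ge geh ck.
  have [fv [fe [Zhe feE]]] := collapseC neh nhe.
  have hk := compat_third gh ghe (collapsible_giso Zhe ck).
  rewrite feE in hk.
  have [gk _] := compat_sym ek.
  have [ckf _] := conf _ gk (same_descent_compat ek).
  exact: conflict_triangle eh ek hk cef chf ckf.
have rZf : reduced (collapse_gtree f).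
  move=> [k nfk] ck.
  have fk : compat f k by split=> //; exists nfk; left.
  have [gk _] := compat_sym fk.
  have ck' g : geom_collapsible g -> same_descent e g -> conflict g k.
    move=> gg eg; case: (@not_same_descent g k) => // gk'.
    apply: nef; apply: same_descent_trans gg eg _.
    apply: same_descent_trans gk gk' _.
    exact/same_descent_sym/same_descent_compat.
  have cek := ck' _ ge (same_descent_geom ge (same_geom_refl e)).
  have chk := ck' _ gh (same_descent_compat eh).
  exact: conflict_square eh fk cef chf cek chk.
apply: nef; apply: same_descent_witness => //.
exists Zeh, (collapse_gtree f); split.
- by apply: (@descends_cons _ (collapse_gtree e)) geh _; apply: descends_refl.
- exact: descends_refl.
- apply: related_sym; apply: related_move; split.
  + by split=> //; apply: D_collapse.
  + by split=> //; apply: D_collapse => //; apply: D_collapse.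
  + apply: Or43; exists Z; split=> //; exists f, e, h; split.
    * by split=> // H; [apply: nsef|apply: nshf]; apply: same_geom_sym.
    * by split=> //; apply: giso_refl.
    * left; split=> //; exists neh; split=> //; exact: giso_refl.
Qed.

Lemma same_descent_all e f :
  geom_collapsible e -> geom_collapsible f -> same_descent e f.
Proof.
have step k k' : geom_collapsible k -> geom_collapsible k' ->
    ~ reduced (collapse_gtree k) -> same_descent k k'.
  move=> gk gk' /existsNP[[h nkh] /contrapT ch].
  apply: (@same_descent_not_reduced k h) => //.
  by split=> //; exists nkh; left.
move=> ge gf; have [re|] := pselect (reduced (collapse_gtree e)); last exact: step.
have [rf|nrf] := pselect (reduced (collapse_gtree f)); last first.
  exact/same_descent_sym/step.
have [ef|nef] := pselect (same_geom e f); first exact: same_descent_geom.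
exact: same_descent_both_reduced.
Qed.

End Peak.

Lemma descends_related n Z : D Z -> rank_le n Z ->
  forall A B, descends Z A -> descends Z B -> related A B.
Proof.
have red Z' : reduced Z' -> forall A B,
    descends Z' A -> descends Z' B -> related A B.
  move=> rZ A B /(descends_of_reduced rZ)/giso_sym ZA.
  move=> /(descends_of_reduced rZ) ZB.
  exact/whitehead_nil/(giso_trans ZA).
elim: n Z => [|n IH] Z DZ; first by move=> /rank_le0 /red.
move=> rZ A B ZA ZB.
have [redZ|nredZ] := pselect (reduced Z); first exact: red ZA ZB.
case: ZA ZB DZ rZ nredZ => {Z A} [Z A /giso_sym ZA rA|Z e A ge eA] ZB DZ rZ nredZ.
  by case: nredZ; apply: reduced_giso rA.
case: ZB e ge eA DZ rZ nredZ => {Z B} [Z B /giso_sym ZB rB|Z f B gf fB] e ge eA DZ rZ.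
  by case; apply: reduced_giso rB.
by move=> _; apply: (same_descent_all DZ rZ IH ge gf) eA fB.
Qed.

Lemma connected_related X Y :
  clos_refl_sym_trans (gtree G) (fun X Y => giso X Y \/ collapse_move X Y) X Y ->
  D X -> (finite_rank X <-> finite_rank Y) /\ (finite_rank X ->
    forall A B, descends X A -> descends Y B -> related A B).
Proof.
have one Z : D Z -> finite_rank Z ->
    forall A B, descends Z A -> descends Z B -> related A B.
  by move=> DZ [n]; apply: descends_related.
elim=> {X Y} [X Y XY|X|X Y XY IH|X Y Z XY IHXY YZ IHYZ] DX.
- case: XY => [XY|[e [ge eY]]].
    split; first by split; apply: finite_rank_giso => //; apply: giso_sym.
    move=> rX A B XA YB; apply: (one X) => //.
    by apply: descends_giso YB; apply: giso_sym.
  split.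
    rewrite -(finite_rank_collapse ge).
    by split; apply: finite_rank_giso => //; apply: giso_sym.
  move=> rX A B XA YB; apply: (one X) => //.
  apply: (descends_cons ge); apply: descends_giso YB.
  exact: giso_sym eY.
- by split=> //; apply: one.
- have [rE H] := IH (rst_trans _ _ _ _ _ DX (rst_sym _ _ _ _ XY)).
  split; first by split=> /rE.
  by move=> /rE rY A B XA YB; apply: related_sym; apply: H.
- have DY := rst_trans _ _ _ _ _ DX XY.
  have [rXY HXY] := IHXY DX; have [rYZ HYZ] := IHYZ DY.
  split; first by rewrite rXY.
  move=> rX A B XA ZB; have [C YC] := descends_exists (rXY.1 rX).
  apply: related_trans (HXY rX _ _ XA YC) _.
  by apply: HYZ ZB => //; apply/rXY.
Qed.

End Whitehead.

Theorem theorem3p2 (G : groupType) (T X Y : gtree G) :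
  deformation_space T X -> deformation_space T Y ->
  reduced X -> reduced Y ->
  whitehead_related (deformation_space T) X Y.
Proof.
move=> DX DY rX rY.
have XY := rst_trans _ _ _ _ _ (rst_sym _ _ _ _ DX) DY.
have [_] := connected_related XY DX; apply.
- by exists 0; apply/rank_le0.
- exact: descends_refl.
- exact: descends_refl.
Qed.
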